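(* Let $x_0,y_0>0$, $\Omega=\{(x,y):0<x<x_0,\ 0<y<y_0\}$, $g,q,b,z_d\in\mathbb{R}$, $\alpha>0$, and let $u,p,u_\alpha,p_\alpha$ be the states and adjoint states defined in the context. Then: i) $$u(x,y)=-g\frac{x^2}{2}+(gx_0-q)x+b,$$ $$p(x,y)=g\frac{x^4}{24}-(gx_0-q)\frac{x^3}{6}-(b-z_d)\frac{x^2}{2}+Ax,$$ where $A=x_0 \Big[g\frac{x_0^2}{3}-q\frac{x_0}{2}+(b-z_d) \Big]$. ii) $$u_{\alpha }(x,y)=-g\frac{x^2}{2}+(gx_0-q)x+\frac{gx_0-q}{\alpha}+ b,$$ $$p_{\alpha }(x,y)=g\frac{x^4}{24}-(gx_0-q)\frac{x^3}{6}-\left(\frac{gx_0-q}{\alpha}+(b-z_d)\right)\frac{x^2}{2}+A_{\alpha }x+\frac{A_{\alpha }}{\alpha},$$ where $A_{\alpha}=x_0\left[ gx_0^2 \left( \frac{1}{3}+\frac{1}{\alpha x_0}\right)-q x_0 \left( \frac{1}{2}+\frac{1}{\alpha x_0}\right)+(b-z_d)\right]$.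
   Context: $\Gamma_1=\{x=0,\ 0\le y\le y_0\}$, $\Gamma_2=\{x=x_0,\ 0\le y\le y_0\}$, $\Gamma_3=\{y=0\text{ or }y=y_0,\ 0<x<x_0\}$; $\partial/\partial n$ is the outward normal derivative. The following are the unique (variational, $H^1(\Omega)$) solutions of the respective mixed problems: $u$: $-\Delta u=g$ in $\Omega$, $u|_{\Gamma_1}=b$, $-\frac{\partial u}{\partial n}|_{\Gamma_2}=q$, $\frac{\partial u}{\partial n}|_{\Gamma_3}=0$; $p$ (adjoint state): $-\Delta p=u-z_d$ in $\Omega$, $p|_{\Gamma_1}=0$, $\frac{\partial p}{\partial n}|_{\Gamma_2}=0$, $\frac{\partial p}{\partial n}|_{\Gamma_3}=0$; $u_\alpha$: $-\Delta u_\alpha=g$ in $\Omega$, $-\frac{\partial u_\alpha}{\partial n}|_{\Gamma_1}=\alpha(u_\alpha-b)$, $-\frac{\partial u_\alpha}{\partial n}|_{\Gamma_2}=q$, $\frac{\partial u_\alpha}{\partial n}|_{\Gamma_3}=0$; $p_\alpha$ (adjoint state): $-\Delta p_\alpha=u_\alpha-z_d$ in $\Omega$, $-\frac{\partial p_\alpha}{\partial n}|_{\Gamma_1}=\alpha p_\alpha$, $\frac{\partial p_\alpha}{\partial n}|_{\Gamma_2}=0$, $\frac{\partial p_\alpha}{\partial n}|_{\Gamma_3}=0$. *)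

(* Defs.v *)
From mathcomp Require Import all_boot all_order all_algebra.
From mathcomp Require Import all_classical all_reals all_analysis.
Set Implicit Arguments.
Unset Strict Implicit.
Unset Printing Implicit Defensive.
Import Order.TTheory GRing.Theory Num.Theory.
Import numFieldNormedType.Exports.
Local Open Scope classical_set_scope.
Local Open Scope ring_scope.

Definition leb1 (R : realType) := @lebesgue_measure R.

Definition leb2 (R : realType) := (@lebesgue_measure R \x @lebesgue_measure R)%E.

Definition Omega (R : realType) (x0 y0 : R) : set (R * R) :=
  `]0, x0[ `*` `]0, y0[.

Definition partial1 (R : realType) (f : R * R -> R) (z : R * R) : R :=
  'D_((1, 0) : R * R) f z.

Definition partial2 (R : realType) (f : R * R -> R) (z : R * R) : R :=
  'D_((0, 1) : R * R) f z.

(* [Ck k f]: all iterated partial derivatives of f of order at most k exist on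
   the whole plane, and those of order k are continuous (hence so are all the
   lower ones). *)
Fixpoint Ck (R : realType) (k : nat) (f : R * R -> R) : Prop :=
  match k with
  | 0 => continuous f
  | k'.+1 => [/\ forall z, derivable f z ((1, 0) : R * R),
                 forall z, derivable f z ((0, 1) : R * R),
                 Ck k' (partial1 f) & Ck k' (partial2 f)]
  end.

Definition smooth (R : realType) (f : R * R -> R) : Prop := forall k, Ck k f.

Definition support_of (R : realType) (f : R * R -> R) : set (R * R) :=
  closure [set z | f z != 0].

Definition test_function (R : realType) (D : set (R * R)) (f : R * R -> R) :=
  [/\ smooth f, compact (support_of f) & support_of f `<=` D].

Definition square_integrable d (T : measurableType d) (R : realType)
    (mu : set T -> \bar R) (D : set T) (f : T -> R) : Prop :=
  measurable_fun D f /\ mu.-integrable D (fun x => (f x ^+ 2)%:E).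

Definition weak_partial (R : realType) (D : set (R * R))
    (partial : (R * R -> R) -> R * R -> R) (v w : R * R -> R) : Prop :=
  forall phi, test_function D phi ->
    \int[@leb2 R]_(z in D) (v z * partial phi z) =
    - \int[@leb2 R]_(z in D) (w z * phi z).

(* An element of H^1(Omega), given by representatives of the function and of
   its weak gradient; only their values a.e. on Omega matter. *)
Record H1 (R : realType) (x0 y0 : R) := MkH1 {
  H1fun :> R * R -> R;
  H1dx : R * R -> R;
  H1dy : R * R -> R;
  H1fun_L2 : square_integrable (@leb2 R) (Omega x0 y0) H1fun;
  H1dx_L2 : square_integrable (@leb2 R) (Omega x0 y0) H1dx;
  H1dy_L2 : square_integrable (@leb2 R) (Omega x0 y0) H1dy;
  H1dxP : weak_partial (Omega x0 y0) (@partial1 R) H1fun H1dx;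
  H1dyP : weak_partial (Omega x0 y0) (@partial2 R) H1fun H1dy
}.

Definition L2_cvg d (T : measurableType d) (R : realType)
    (mu : set T -> \bar R) (D : set T) (f : nat -> T -> R) (g : T -> R) :=
  (fun n => \int[mu]_(x in D) ((f n x - g x) ^+ 2)%:E)%E @ \oo --> 0%E.

Definition H1_cvg (R : realType) (x0 y0 : R)
    (f : nat -> R * R -> R) (v : H1 x0 y0) : Prop :=
  [/\ L2_cvg (@leb2 R) (Omega x0 y0) f v,
      L2_cvg (@leb2 R) (Omega x0 y0) (fun n => partial1 (f n)) (H1dx v) &
      L2_cvg (@leb2 R) (Omega x0 y0) (fun n => partial2 (f n)) (H1dy v)].

(* Convergence in L^2 of the edge [e @` `[0, l]], e being an arc-length
   parametrization. *)
Definition edge_cvg (R : realType) (e : R -> R * R) (l : R)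
    (f : nat -> R * R -> R) (t : R * R -> R) : Prop :=
  square_integrable (@leb1 R) `[0, l] (t \o e) /\
  L2_cvg (@leb1 R) `[0, l] (fun n => f n \o e) (t \o e).

(* The graph of the trace operator from H^1(Omega) to L^2 of the boundary, i.e.
   of the continuous extension of the restriction map from the (dense) subspace
   of functions smooth up to the boundary. Only the values of t a.e. on the
   boundary of Omega (for arc length) matter. *)
Definition trace (R : realType) (x0 y0 : R) (v : H1 x0 y0)
    (t : R * R -> R) : Prop :=
  exists f : nat -> R * R -> R,
    [/\ forall n, smooth (f n), H1_cvg f v,
        edge_cvg (fun y => (0, y)) y0 f t /\ edge_cvg (fun y => (x0, y)) y0 f t &
        edge_cvg (fun x => (x, 0)) x0 f t /\ edge_cvg (fun x => (x, y0)) x0 f t].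

Definition int_Omega (R : realType) (x0 y0 : R) (f : R * R -> R) : R :=
  \int[@leb2 R]_(z in Omega x0 y0) f z.

Definition int_Gamma1 (R : realType) (y0 : R) (f : R * R -> R) : R :=
  \int[@leb1 R]_(y in `[0, y0]) f (0, y).

Definition int_Gamma2 (R : realType) (x0 y0 : R) (f : R * R -> R) : R :=
  \int[@leb1 R]_(y in `[0, y0]) f (x0, y).

Definition cst_on_Gamma1 (R : realType) (y0 : R) (t : R * R -> R) (c : R) :=
  ae_eq (@leb1 R) `[0, y0]%classic (fun y => t (0, y)) (cst c).

Definition int_grad_grad (R : realType) (x0 y0 : R) (u v : H1 x0 y0) : R :=
  int_Omega x0 y0 (fun z => H1dx u z * H1dx v z + H1dy u z * H1dy v z).

(* The four predicates below are the variational formulations of the mixed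
   problems: multiply by v, apply Green's formula, and substitute the Neumann
   or Robin data for the normal derivative. The homogeneous Neumann condition
   on Gamma3 is natural and leaves no term. *)

Definition is_state (R : realType) (x0 y0 g q b : R) (u : H1 x0 y0) : Prop :=
  (exists2 t, trace u t & cst_on_Gamma1 y0 t b) /\
  forall (v : H1 x0 y0) (s : R * R -> R),
    trace v s -> cst_on_Gamma1 y0 s 0 ->
    int_grad_grad u v =
    int_Omega x0 y0 (fun z => g * v z) - int_Gamma2 x0 y0 (fun z => q * s z).

Definition is_adjoint (R : realType) (x0 y0 zd : R) (u p : H1 x0 y0) : Prop :=
  (exists2 t, trace p t & cst_on_Gamma1 y0 t 0) /\
  forall (v : H1 x0 y0) (s : R * R -> R),
    trace v s -> cst_on_Gamma1 y0 s 0 ->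
    int_grad_grad p v = int_Omega x0 y0 (fun z => (u z - zd) * v z).

Definition is_state_alpha (R : realType) (x0 y0 g q b alpha : R)
    (u : H1 x0 y0) : Prop :=
  exists2 t, trace u t &
  forall (v : H1 x0 y0) (s : R * R -> R), trace v s ->
    int_grad_grad u v + int_Gamma1 y0 (fun z => alpha * (t z - b) * s z) =
    int_Omega x0 y0 (fun z => g * v z) - int_Gamma2 x0 y0 (fun z => q * s z).

Definition is_adjoint_alpha (R : realType) (x0 y0 zd alpha : R)
    (u p : H1 x0 y0) : Prop :=
  exists2 t, trace p t &
  forall (v : H1 x0 y0) (s : R * R -> R), trace v s ->
    int_grad_grad p v + int_Gamma1 y0 (fun z => alpha * t z * s z) =
    int_Omega x0 y0 (fun z => (u z - zd) * v z).

(* Main.v *)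
Require Import Defs.
From mathcomp Require Import all_boot all_order all_algebra.
From mathcomp Require Import all_classical all_reals all_analysis.
From mathcomp Require Import measurable_realfun ring lra.
Set Implicit Arguments.
Unset Strict Implicit.
Unset Printing Implicit Defensive.
Import Order.TTheory GRing.Theory Num.Theory.
Import numFieldNormedType.Exports.
Local Open Scope classical_set_scope.
Local Open Scope ring_scope.

(** Each of the four problems is linear, and its data depend on x alone. So
    the solution is the polynomial in x that solves the corresponding two-point
    boundary value problem, and the work is to show that this polynomial is a
    variational solution and that no other element of H^1 is one.

    Existence. For a polynomial P, Green's formula [H1_Green] applied to P'
    turns the energy of P against a test function v with trace s into

      int grad P . grad v =
        P'(x0) int_Gamma2 s - P'(0) int_Gamma1 s - int P'' v,

    so the variational equations reduce to identities on the coefficients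
    ([state_energy], [adjoint_energy]). The Dirichlet and Robin problems are
    solved by the same two families of polynomials. In the Robin case
    the constant term of the state is b + (g x0 - q) / alpha instead of b, and
    the constant term of the adjoint state is A_alpha / alpha instead of 0.

    Uniqueness. Let w be the difference of a solution and the explicit one, and
    t the difference of their traces. Testing with w itself gives
    int |grad w|^2 = 0 with t = 0 on Gamma1 (Dirichlet), or
    int |grad w|^2 + alpha int_Gamma1 t^2 = 0 (Robin). In both cases the
    Poincare inequality with a trace term,

      int w^2 <= 2 x0 int_Gamma1 t^2 + 4 x0^2 int (d w / d x)^2,

    proved in [Poincare_trace], forces w = 0 almost everywhere.

    Both Green's formula and this inequality come from one fact about smooth
    functions F, Fubini and the fundamental theorem of calculus on the rectangle:
    int_Omega (d F / d x) is the integral over y of F(x0, y) - F(0, y). The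
    trace of an element of H^1 is a limit of restrictions of smooth functions,
    so both extend to H^1 because integrals against a fixed square-integrable
    function, and squared norms, are continuous under convergence in L^2
    ([L2_cvg_Rintegral], [L2_cvg_Rintegral_sqr]). *)

(** * Square-integrable functions *)

Section SquareIntegrable.
Context d (T : measurableType d) (R : realType) (mu : {measure set T -> \bar R}).
Variables (D : set T) (mD : measurable D).
Implicit Types f g k : T -> R.

Lemma L2_mul_integrable f g :
  square_integrable mu D f -> square_integrable mu D g ->
  mu.-integrable D (EFin \o (fun x => f x * g x)).
Proof.
move=> [mf f2] [mg g2].
apply: (@le_integrable _ _ _ mu D mD _ (fun x => (f x ^+ 2)%:E + (g x ^+ 2)%:E)%E).
- by apply/measurable_EFinP; exact: measurable_funM.
- move=> x _ /=; rewrite lee_fin.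
  have ->: `|f x ^+ 2 + g x ^+ 2| = `|f x| ^+ 2 + `|g x| ^+ 2.
    by rewrite ger0_norm ?addr_ge0 ?sqr_ge0// !real_normK ?num_real.
  by rewrite normrM; nra.
- exact: integrableD.
Qed.

Lemma integrable_EFinZl r f : mu.-integrable D (EFin \o f) ->
  mu.-integrable D (EFin \o (fun x => r * f x)).
Proof. exact: integrableZl. Qed.

Lemma L2_sqr_integrable f : square_integrable mu D f ->
  mu.-integrable D (EFin \o (fun x => f x ^+ 2)).
Proof. by case. Qed.

Lemma L2B f g :
  square_integrable mu D f -> square_integrable mu D g ->
  square_integrable mu D (fun x => f x - g x).
Proof.
move=> sf sg; split; first by apply: measurable_funB; [case: sf|case: sg].
have -> : (fun x => ((f x - g x) ^+ 2)%:E) =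
    (fun x => (f x ^+ 2)%:E + (g x ^+ 2)%:E - 2%:E * (f x * g x)%:E)%E.
  by apply/funext => x; rewrite -EFinM -!EFinD; congr EFin; ring.
apply: integrableB => //; first by apply: integrableD; [|case: sf|case: sg].
by apply: integrableZl => //; exact: L2_mul_integrable.
Qed.

Lemma bounded_L2 f (M : R) : (mu D < +oo)%E ->
  measurable_fun D f -> (forall x, D x -> `|f x| <= M) ->
  square_integrable mu D f.
Proof.
move=> muD mf fM; split => //.
apply: (@measurable_bounded_integrable _ _ _ mu (fun x => f x ^+ 2)) => //.
  exact: measurable_funX.
exists (M ^+ 2); split; first exact: num_real.
move=> e Me x /= Dx; rewrite normrX (le_trans _ (ltW Me))//.
by rewrite lerXn2r ?nnegrE// ?fM// (le_trans _ (fM _ Dx)).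
Qed.

(** The quadratic polynomial s |-> int (f + s g)^2 is nonnegative. *)
Lemma CauchySchwarz_Rintegral f g :
  square_integrable mu D f -> square_integrable mu D g ->
  (\int[mu]_(x in D) (f x * g x)) ^+ 2 <=
  (\int[mu]_(x in D) (f x ^+ 2)) * (\int[mu]_(x in D) (g x ^+ 2)).
Proof.
move=> sf sg.
have ifg := L2_mul_integrable sf sg.
have if2 := L2_sqr_integrable sf; have ig2 := L2_sqr_integrable sg.
set a := \int[mu]_(x in D) (f x * g x).
set F := \int[mu]_(x in D) (f x ^+ 2); set G := \int[mu]_(x in D) (g x ^+ 2).
have quad s : 0 <= F + (2 * s) * a + s ^+ 2 * G.
  have -> : F + (2 * s) * a + s ^+ 2 * G = \int[mu]_(x in D) ((f x + s * g x) ^+ 2).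
    rewrite /F /a /G -!RintegralZl// -!RintegralD//.
    - by apply: eq_Rintegral => x _; ring.
    - have -> : (EFin \o (fun x => f x ^+ 2 + 2 * s * (f x * g x))) =
        (fun x => (f x ^+ 2)%:E + (2 * s)%:E * (f x * g x)%:E)%E by [].
      by apply: integrableD => //; exact: integrableZl.
    - exact: integrable_EFinZl.
    - exact: integrable_EFinZl.
  by apply: Rintegral_ge0 => x _; exact: sqr_ge0.
have G0 : 0 <= G by apply: Rintegral_ge0 => x _; exact: sqr_ge0.
have F0 : 0 <= F by apply: Rintegral_ge0 => x _; exact: sqr_ge0.
have [G_gt0|] := ltP 0 G.
  have := quad (- a / G).
  have -> : F + 2 * (- a / G) * a + (- a / G) ^+ 2 * G = (F * G - a ^+ 2) / G.
    by field; rewrite gt_eqF.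
  by rewrite pmulr_lge0 ?invr_gt0// subr_ge0.
move=> Gle0; have GE : G = 0 by apply/le_anti/andP.
rewrite GE mulr0; case: (eqVneq a 0) => [->|an0]; first by rewrite expr0n.
(* With G = 0 the quadratic is affine; at this s it takes the value -1. *)
have := quad (- (F + 1) / (2 * a)); rewrite GE mulr0 addr0.
have -> : F + 2 * (- (F + 1) / (2 * a)) * a = -1.
  by field; rewrite an0.
by rewrite ler0N1.
Qed.

(** By Cauchy-Schwarz, the error is at most (int k^2)^(1/2) |f_n - g|_2. *)
Lemma L2_cvg_Rintegral (f : nat -> T -> R) g k :
  (forall n, square_integrable mu D (f n)) -> square_integrable mu D g ->
  square_integrable mu D k -> L2_cvg mu D f g ->
  (fun n => \int[mu]_(x in D) (k x * f n x)) @ \oo -->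
  (\int[mu]_(x in D) (k x * g x) : R).
Proof.
move=> sf sg sk fg.
pose H := \int[mu]_(x in D) (k x ^+ 2).
pose E n := \int[mu]_(x in D) ((f n x - g x) ^+ 2).
have E0 : E n @[n --> \oo] --> (0 : R).
  by have := fine_cvg fg; apply.
have sqrtE : Num.sqrt (H * E n) @[n --> \oo] --> (0 : R).
  rewrite -[X in _ --> X]sqrtr0 -(mulr0 H).
  by apply: continuous_cvg; [exact: sqrt_continuous|exact: cvgMr].
apply/subr_cvg0; apply: (squeeze_cvgr _ _ sqrtE).
  2: by rewrite -oppr0; exact: cvgN sqrtE.
near=> n.
rewrite -RintegralB ?L2_mul_integrable//.
under eq_Rintegral do rewrite -mulrBr.
by rewrite -ler_norml -sqrtr_sqr ler_wsqrtr// CauchySchwarz_Rintegral//; exact: L2B.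
Unshelve. all: by end_near. Qed.

(** From f_n^2 = (f_n - g)^2 + 2 g f_n - g^2, where the first term vanishes in
    the limit and the second is a pairing against a fixed function. *)
Lemma L2_cvg_Rintegral_sqr (f : nat -> T -> R) g :
  (forall n, square_integrable mu D (f n)) -> square_integrable mu D g ->
  L2_cvg mu D f g ->
  (fun n => \int[mu]_(x in D) (f n x ^+ 2)) @ \oo -->
  (\int[mu]_(x in D) (g x ^+ 2) : R).
Proof.
move=> sf sg fg.
have E0 : \int[mu]_(x in D) ((f n x - g x) ^+ 2) @[n --> \oo] --> (0 : R).
  by have := fine_cvg fg; apply.
have gfn := L2_cvg_Rintegral sf sg sg fg.
rewrite (_ : (fun n => _) = (fun n => \int[mu]_(x in D) ((f n x - g x) ^+ 2) +
  2 * \int[mu]_(x in D) (g x * f n x) - \int[mu]_(x in D) (g x * g x))).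
  rewrite [X in _ --> X](_ : _ = 0 + 2 * \int[mu]_(x in D) (g x * g x)
    - \int[mu]_(x in D) (g x * g x)); last first.
    rewrite add0r mulr2n mulrDl mul1r addrK.
    by apply: eq_Rintegral => x _; rewrite expr2.
  exact: (cvgB (cvgD E0 (cvgM (cvg_cst (2 : R)) gfn)) (cvg_cst _)).
apply/funext => n.
have i1 := L2_sqr_integrable (L2B (sf n) sg).
have i2 := L2_mul_integrable sg (sf n).
have i3 := L2_mul_integrable sg sg.
have i4 : mu.-integrable D (EFin \o (fun x => 2 * (g x * f n x))).
  exact: integrable_EFinZl.
rewrite -RintegralZl// -RintegralD// -RintegralB//.
- by apply: eq_Rintegral => x _; ring.
- have -> : (EFin \o (fun x => (f n x - g x) ^+ 2 + 2 * (g x * f n x))) =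
    (fun x => ((f n x - g x) ^+ 2)%:E + (2 * (g x * f n x))%:E)%E by [].
  exact: integrableD.
Qed.

Lemma Rintegral_sqr_eq0 f : square_integrable mu D f ->
  \int[mu]_(x in D) (f x ^+ 2) = 0 -> ae_eq mu D f (cst 0).
Proof.
move=> sf f0.
have if2 := L2_sqr_integrable sf.
have mf2 : measurable_fun D (fun x => (f x ^+ 2)%:E) by exact: measurable_int if2.
have : (\int[mu]_(x in D) `|(f x ^+ 2)%:E| = 0)%E.
  under eq_integral do rewrite gee0_abs ?lee_fin ?sqr_ge0//.
  by rewrite -[LHS]fineK ?(integrable_fin_num mD if2)//; congr EFin.
move=> /(ae_eq_integral_abs mu mD mf2); apply: filterS => x /[apply] -[] /eqP.
by rewrite sqrf_eq0 => /eqP.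
Qed.

Lemma ae_eq_Rintegral f g : measurable_fun D f -> measurable_fun D g ->
  ae_eq mu D f g -> \int[mu]_(x in D) f x = \int[mu]_(x in D) g x.
Proof.
move=> mf mg fg; rewrite /Rintegral; congr fine; apply: ae_eq_integral => //.
- exact/measurable_EFinP.
- exact/measurable_EFinP.
- exact: (ae_eq_comp EFin).
Qed.

End SquareIntegrable.

(** * Continuous functions on the plane *)

(** The plane is second countable: an open set is the union of the squares with
    rational centre and half-side that it contains, so the product sigma-algebra
    has all the Borel sets. *)
Lemma open_measurable_prod (R : realType) (U : set (R * R)) :
  open U -> measurable (U : set (measurableTypeR R * measurableTypeR R)).
Proof.
move=> oU.
pose B (q r : rat) : set R := ball (ratr q : R) (ratr r).
pose C (q1 q2 r : rat) : set (R * R) := B q1 r `*` B q2 r.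
have -> : U = \bigcup_q1 \bigcup_q2 \bigcup_r
    (if `[< C q1 q2 r `<=` U >] then C q1 q2 r else set0).
  apply/seteqP; split=> [[x y] Uxy|z [q1 _] [q2 _] [r _]]; last first.
    by case: ifPn => [/asboolP|_ []]; apply.
  have /nbhs_ballP[e /= e0 eU] : nbhs (x, y) U by exact: open_nbhs_nbhs.
  have [r re] : exists r : rat, 0 < (ratr r : R) < e / 2.
    have [r] := rat_in_itvoo (divr_gt0 e0 (ltr0n R 2)).
    by rewrite in_itv/=; exists r.
  have /andP[r0 re2] := re.
  have near_rat (t : R) : exists q : rat, `|ratr q - t| < ratr r :> R.
    have [|q] := @rat_in_itvoo R t (t + ratr r); first by rewrite ltrDl.
    rewrite in_itv/= => /andP[tq qt]; exists q.
    by rewrite gtr0_norm ?subr_gt0// ltrBlDl.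
  have [q1 q1x] := near_rat x; have [q2 q2y] := near_rat y.
  exists q1 => //; exists q2 => //; exists r => //.
  rewrite ifT; first by split.
  apply/asboolP => -[s t] [/= sq1 tq2]; apply: eU; split => /=.
  - move: q1x sq1; rewrite distrC /B/= /ball/= => q1x sq1.
    by have := ler_distD (ratr q1) x s; lra.
  - move: q2y tq2; rewrite distrC /B/= /ball/= => q2y tq2.
    by have := ler_distD (ratr q2) y t; lra.
do 3 (apply: bigcupT_measurable_rat => ?).
case: ifPn => // _; apply: measurableX; exact: measurable_ball.
Qed.

Lemma continuous_measurable_prod (R : realType) (f : R * R -> R) :
  continuous f ->
  measurable_fun (setT : set (measurableTypeR R * measurableTypeR R)) f.
Proof.
move=> /continuousP cf; apply: (measurability _ (RGenOpens.measurableE R)).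
move=> _ [_ [a [b ->] <-]]; rewrite setTI; apply: open_measurable_prod.
exact/cf/interval_open.
Qed.

Lemma measurable_Omega (R : realType) (x0 y0 : R) :
  measurable (Omega x0 y0 : set (measurableTypeR R * measurableTypeR R)).
Proof. by apply: measurableX; exact: measurable_itv. Qed.

Lemma leb2_Omega_lty (R : realType) (x0 y0 : R) : (@leb2 R (Omega x0 y0) < +oo)%E.
Proof.
rewrite /leb2 /Omega product_measure1E//= !lebesgue_measure_itv/= !lte_fin.
by case: ifP => _; case: ifP => _; rewrite -?EFinB ?mul0e ?mule0 -?EFinM ?ltry.
Qed.

(** The closed rectangle is compact, so f is bounded on it. *)
Lemma continuous_Omega_L2 (R : realType) (x0 y0 : R) (f : R * R -> R) :
  continuous f -> square_integrable (@leb2 R) (Omega x0 y0) f.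
Proof.
move=> cf.
have cK : compact (f @` (`[0, x0] `*` `[0, y0])).
  apply: continuous_compact; first exact: continuous_subspaceT.
  by apply: compact_setX; exact: segment_compact.
have [M [_ MK]] := compact_bounded cK.
apply: (@bounded_L2 _ _ _ _ _ (measurable_Omega x0 y0) _ (M + 1)).
- exact: leb2_Omega_lty.
- by apply: measurable_funTS; exact: continuous_measurable_prod.
- move=> -[x y] [/= xI yI]; apply: MK; first by rewrite ltrDl.
  by exists (x, y) => //; split; exact: subset_itv_oo_cc.
Qed.

Lemma continuous_itv_L2 (R : realType) (l : R) (f : R -> R) :
  continuous f -> square_integrable (@leb1 R) `[0, l] f.
Proof.
move=> cf.
have cK : compact (f @` `[0, l]).
  by apply: continuous_compact; [exact: continuous_subspaceT|exact: segment_compact].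
have [M [_ MK]] := compact_bounded cK.
apply: (@bounded_L2 _ _ _ _ _ _ _ (M + 1)) => //.
- rewrite /leb1/= lebesgue_measure_itv/= lte_fin.
  by case: ifP => _; rewrite -?EFinB ltry.
- by apply: measurable_funTS; exact: continuous_measurable_fun.
- by move=> x xI; apply: MK; [rewrite ltrDl|exists x].
Qed.

(** * Integrals of partial derivatives over the rectangle *)

Section IntegralOfPartials.
Variables (R : realType) (x0 y0 : R).
Hypotheses (hx0 : 0 < x0) (hy0 : 0 < y0).
Implicit Types (f F G : R * R -> R).

Let mOmega_integrable G : continuous G ->
  (@leb2 R).-integrable setT ((EFin \o G) \_ (Omega x0 y0)).
Proof.
move=> cG; apply/(integrable_mkcond _ (measurable_Omega x0 y0)).
have := L2_mul_integrable (measurable_Omega x0 y0) (continuous_Omega_L2 x0 y0 cG)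
  (continuous_Omega_L2 x0 y0 (@cst_continuous _ _ (1 : R))).
by under [X in _.-integrable _ (EFin \o X)]funext do rewrite mulr1.
Qed.

Lemma integral_Omega_yx G : continuous G ->
  (\int[@leb2 R]_(z in Omega x0 y0) (G z)%:E =
   \int[@leb1 R]_(y in `]0%R, y0[) \int[@leb1 R]_(x in `]0%R, x0[) (G (x, y))%:E)%E.
Proof.
move=> cG; rewrite integral_mkcond.
have := integral21_prod_meas1 (mOmega_integrable cG); rewrite /leb2 => <-.
rewrite [RHS]integral_mkcond; apply: eq_integral => y _.
rewrite /fubini_G [RHS]patchE; case: ifPn => yI.
  rewrite [RHS]integral_mkcond; apply: eq_integral => x _.
  rewrite !patchE; congr (if _ then _ else _).
  by apply/idP/idP; rewrite !inE /Omega/=; move: yI; rewrite inE/= => yI; [case|].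
apply: integral0_eq => x _; rewrite patchE ifF//.
by apply/negP; rewrite inE => -[_ /= yI']; move/negP: yI; apply; rewrite inE.
Qed.

Lemma integral_Omega_xy G : continuous G ->
  (\int[@leb2 R]_(z in Omega x0 y0) (G z)%:E =
   \int[@leb1 R]_(x in `]0%R, x0[) \int[@leb1 R]_(y in `]0%R, y0[) (G (x, y))%:E)%E.
Proof.
move=> cG; rewrite integral_mkcond.
have := integral12_prod_meas1 (mOmega_integrable cG); rewrite /leb2 => <-.
rewrite [RHS]integral_mkcond; apply: eq_integral => x _.
rewrite /fubini_F [RHS]patchE; case: ifPn => xI.
  rewrite [RHS]integral_mkcond; apply: eq_integral => y _.
  rewrite !patchE; congr (if _ then _ else _).
  by apply/idP/idP; rewrite !inE /Omega/=; move: xI; rewrite inE/= => xI; [case|].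
apply: integral0_eq => y _; rewrite patchE ifF//.
by apply/negP; rewrite inE => -[/= xI' _]; move/negP: xI; apply; rewrite inE.
Qed.

Lemma continuous_xslice F (y : R) : continuous F -> continuous (fun x : R => F (x, y)).
Proof.
move=> cF x; apply: (@continuous_comp _ _ _ (fun t : R => (t, y)) F); last exact: cF.
apply: (@cvg_pair _ _ _ (nbhs x) (nbhs x) (nbhs y) _ _ _ (fun t : R => t)).
- exact: cvg_id.
- exact: cvg_cst.
Qed.

Lemma continuous_yslice F (x : R) : continuous F -> continuous (fun y : R => F (x, y)).
Proof.
move=> cF y; apply: (@continuous_comp _ _ _ (fun t : R => (x, t)) F); last exact: cF.
apply: (@cvg_pair _ _ _ (nbhs y) (nbhs x) (nbhs y) _ _ _ (fun=> x)).
- exact: cvg_cst.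
- exact: cvg_id.
Qed.

Lemma is_derive_xslice F (x y d : R) :
  is_derive (x, y) ((1, 0) : R * R) F d <->
  is_derive x (1 : R) (fun t : R => F (t, y)) d.
Proof.
have E : (fun h : R => h^-1 *: ((F \o shift (x, y)) (h *: ((1, 0) : R * R)) - F (x, y)))
  = (fun h : R => h^-1 *:
      (((fun t : R => F (t, y)) \o shift x) (h *: (1 : R)) - F (x, y))).
  apply/funext => h /=; congr (_ *: (F _ - _)).
  by apply: injective_projections => //=; rewrite scaler0 add0r.
by split=> -[dF <-]; apply: DeriveDef; move: dF; rewrite /derivable /derive E.
Qed.

Lemma is_derive_yslice F (x y d : R) :
  is_derive (x, y) ((0, 1) : R * R) F d <->
  is_derive y (1 : R) (fun t : R => F (x, t)) d.
Proof.
have E : (fun h : R => h^-1 *: ((F \o shift (x, y)) (h *: ((0, 1) : R * R)) - F (x, y)))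
  = (fun h : R => h^-1 *:
      (((fun t : R => F (x, t)) \o shift y) (h *: (1 : R)) - F (x, y))).
  apply/funext => h /=; congr (_ *: (F _ - _)).
  by apply: injective_projections => //=; rewrite scaler0 add0r.
by split=> -[dF <-]; apply: DeriveDef; move: dF; rewrite /derivable /derive E.
Qed.

Lemma FTC_itvoo (phi dphi : R -> R) (l : R) : 0 < l ->
  continuous phi -> continuous dphi ->
  (forall x : R, is_derive x (1 : R) phi (dphi x)) ->
  (\int[@leb1 R]_(x in `]0%R, l[) (dphi x)%:E = (phi l - phi 0)%:E)%E.
Proof.
move=> l0 cphi cdphi dphiE.
have mdphi D : measurable_fun D (EFin \o dphi).
  by apply/measurable_EFinP; apply: measurable_funTS; exact: continuous_measurable_fun.
rewrite /leb1 integral_itv_obnd_cbnd// integral_itv_bndo_bndc//.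
rewrite (@continuous_FTC2 _ _ phi)//.
- exact: continuous_subspaceT.
- split.
  + by move=> x _; case: (dphiE x).
  + by apply: cvg_at_right_filter; exact: cphi.
  + by apply: cvg_at_left_filter; exact: cphi.
- by move=> x _; rewrite derive1E; case: (dphiE x).
Qed.

(** Fubini reduces to the fundamental theorem of calculus on each horizontal
    slice. *)
Lemma int_Omega_partial1 F :
  continuous F -> (forall z, derivable F z ((1, 0) : R * R)) ->
  continuous (partial1 F) ->
  int_Omega x0 y0 (partial1 F) =
  \int[@leb1 R]_(y in `[0, y0]) (F (x0, y) - F (0, y)).
Proof.
move=> cF dF cdF; rewrite /int_Omega /Rintegral integral_Omega_yx//.
have mF D : measurable_fun D (EFin \o (fun y : R => F (x0, y) - F (0, y))).
  apply/measurable_EFinP; apply: measurable_funTS; apply: continuous_measurable_fun.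
  by move=> y; apply: cvgB; exact: continuous_yslice.
rewrite /leb1 -integral_itv_bndo_bndc// -integral_itv_obnd_cbnd//.
congr fine; apply: eq_integral => y _.
apply: (@FTC_itvoo (fun x => F (x, y)) (fun x => partial1 F (x, y))) => //.
- exact: continuous_xslice.
- exact: continuous_xslice.
- by move=> x; apply/is_derive_xslice; exact: derivableP.
Qed.

Lemma int_Omega_partial2 F :
  continuous F -> (forall z, derivable F z ((0, 1) : R * R)) ->
  continuous (partial2 F) ->
  int_Omega x0 y0 (partial2 F) =
  \int[@leb1 R]_(x in `[0, x0]) (F (x, y0) - F (x, 0)).
Proof.
move=> cF dF cdF; rewrite /int_Omega /Rintegral integral_Omega_xy//.
have mF D : measurable_fun D (EFin \o (fun x : R => F (x, y0) - F (x, 0))).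
  apply/measurable_EFinP; apply: measurable_funTS; apply: continuous_measurable_fun.
  by move=> x; apply: cvgB; exact: continuous_xslice.
rewrite /leb1 -integral_itv_bndo_bndc// -integral_itv_obnd_cbnd//.
congr fine; apply: eq_integral => x _.
apply: (@FTC_itvoo (fun y => F (x, y)) (fun y => partial2 F (x, y))) => //.
- exact: continuous_yslice.
- exact: continuous_yslice.
- by move=> y; apply/is_derive_yslice; exact: derivableP.
Qed.

End IntegralOfPartials.

(** * Smooth functions and the elements of H^1 they define *)

Section Smooth.
Variable R : realType.
Implicit Types (f g : R * R -> R) (P Q : {poly R}).

Lemma smooth_continuous f : smooth f -> continuous f.
Proof. by move=> /(_ 0%N). Qed.

Lemma smooth_derivable1 f : smooth f -> forall z, derivable f z ((1, 0) : R * R).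
Proof. by move=> /(_ 1%N)[]. Qed.

Lemma smooth_derivable2 f : smooth f -> forall z, derivable f z ((0, 1) : R * R).
Proof. by move=> /(_ 1%N)[]. Qed.

Lemma smooth_partial1 f : smooth f -> smooth (partial1 f).
Proof. by move=> sf k; have [] := sf k.+1. Qed.

Lemma smooth_partial2 f : smooth f -> smooth (partial2 f).
Proof. by move=> sf k; have [] := sf k.+1. Qed.

Lemma partial1B f g : smooth f -> smooth g ->
  partial1 (f \- g) = partial1 f \- partial1 g.
Proof.
move=> sf sg; apply/funext => z.
by apply: deriveB; exact: smooth_derivable1.
Qed.

Lemma partial2B f g : smooth f -> smooth g ->
  partial2 (f \- g) = partial2 f \- partial2 g.
Proof.
move=> sf sg; apply/funext => z.
by apply: deriveB; exact: smooth_derivable2.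
Qed.

Lemma partial1M f g : smooth f -> smooth g ->
  partial1 (f \* g) = (fun z => f z * partial1 g z + partial1 f z * g z).
Proof.
move=> sf sg; apply/funext => z; rewrite [partial1 f z * _]mulrC.
by apply: deriveM; exact: smooth_derivable1.
Qed.

Lemma partial2M f g : smooth f -> smooth g ->
  partial2 (f \* g) = (fun z => f z * partial2 g z + partial2 f z * g z).
Proof.
move=> sf sg; apply/funext => z; rewrite [partial2 f z * _]mulrC.
by apply: deriveM; exact: smooth_derivable2.
Qed.

Lemma CkD k f g : Ck k f -> Ck k g -> Ck k (f \+ g).
Proof.
elim: k f g => [|k IH] f g /=; first by move=> cf cg z; exact: cvgD (cf z) (cg z).
move=> [f1 f2 cf1 cf2] [g1 g2 cg1 cg2]; split.
- by move=> z; exact: derivableD.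
- by move=> z; exact: derivableD.
- rewrite (_ : partial1 _ = partial1 f \+ partial1 g); first exact: IH.
  by apply/funext => z; exact: deriveD.
- rewrite (_ : partial2 _ = partial2 f \+ partial2 g); first exact: IH.
  by apply/funext => z; exact: deriveD.
Qed.

(** The induction is on the order of derivation but over all smooth f and g,
    since [Ck k.+1] alone does not give [Ck k] without a mean value argument. *)
Lemma smoothM f g : smooth f -> smooth g -> smooth (f \* g).
Proof.
move=> + + k; elim: k f g => [|k IH] f g sf sg.
  by move=> z; apply: cvgM; exact: smooth_continuous.
have [sf1 sf2] := (smooth_partial1 sf, smooth_partial2 sf).
have [sg1 sg2] := (smooth_partial1 sg, smooth_partial2 sg).
split.
- by move=> z; apply: derivableM; exact: smooth_derivable1.
- by move=> z; apply: derivableM; exact: smooth_derivable2.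
- by rewrite partial1M//; apply: CkD; exact: IH.
- by rewrite partial2M//; apply: CkD; exact: IH.
Qed.

(** All explicit solutions are of this form: polynomials in the first coordinate,
    a class closed under both partial derivatives. *)
Definition xpoly P : R * R -> R := fun z => P.[z.1].

Lemma xpoly_is_derive1 P z : is_derive z ((1, 0) : R * R) (xpoly P) (xpoly P^`() z).
Proof. by case: z => x y; apply/is_derive_xslice; exact: is_derive_poly. Qed.

Lemma xpoly_is_derive2 P z : is_derive z ((0, 1) : R * R) (xpoly P) 0.
Proof. by case: z => x y; apply/is_derive_yslice; exact: (is_derive_cst P.[x]). Qed.

Lemma partial1_xpoly P : partial1 (xpoly P) = xpoly P^`().
Proof. by apply/funext => z; case: (xpoly_is_derive1 P z). Qed.

Lemma partial2_xpoly P : partial2 (xpoly P) = xpoly 0.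
Proof.
by apply/funext => z; rewrite /xpoly horner0; case: (xpoly_is_derive2 P z).
Qed.

Lemma smooth_xpoly P : smooth (xpoly P).
Proof.
move=> k; elim: k P => [|k IH] P.
  move=> z; apply: (@continuous_comp _ _ _ fst (horner P)); first exact: cvg_fst.
  exact: continuous_horner.
split.
- by move=> z; case: (xpoly_is_derive1 P z).
- by move=> z; case: (xpoly_is_derive2 P z).
- by rewrite partial1_xpoly.
- by rewrite partial2_xpoly.
Qed.

Lemma smoothB f g : smooth f -> smooth g -> smooth (f \- g).
Proof.
move=> sf sg.
have -> : f \- g = f \+ (xpoly (-1)%:P \* g).
  by apply/funext => z /=; rewrite /xpoly hornerC mulN1r.
by move=> k; apply: CkD => //; apply: smoothM => //; exact: smooth_xpoly.
Qed.

Lemma test_function_out (D : set (R * R)) phi z :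
  test_function D phi -> ~ D z -> phi z = 0.
Proof.
move=> [_ _ sub] Dz; apply/eqP/negPn/negP => phiz.
by apply/Dz/sub/subset_closure.
Qed.

Variables (x0 y0 : R).
Hypotheses (hx0 : 0 < x0) (hy0 : 0 < y0).
Notation Om := (Omega x0 y0).
Notation sqiO := (square_integrable (@leb2 R) Om).

Lemma smooth_L2 f : smooth f -> sqiO f.
Proof. by move/smooth_continuous; exact: continuous_Omega_L2. Qed.

Lemma integrable_OmegaM f g : sqiO f -> sqiO g ->
  (@leb2 R).-integrable Om (EFin \o (fun z => f z * g z)).
Proof. exact: (L2_mul_integrable (measurable_Omega x0 y0)). Qed.

Lemma int_OmegaD f g :
  (@leb2 R).-integrable Om (EFin \o f) -> (@leb2 R).-integrable Om (EFin \o g) ->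
  int_Omega x0 y0 (fun z => f z + g z) = int_Omega x0 y0 f + int_Omega x0 y0 g.
Proof. exact: (RintegralD (measurable_Omega x0 y0)). Qed.

Lemma int_OmegaB f g :
  (@leb2 R).-integrable Om (EFin \o f) -> (@leb2 R).-integrable Om (EFin \o g) ->
  int_Omega x0 y0 (fun z => f z - g z) = int_Omega x0 y0 f - int_Omega x0 y0 g.
Proof. exact: (RintegralB (measurable_Omega x0 y0)). Qed.

Lemma int_OmegaZ r f : (@leb2 R).-integrable Om (EFin \o f) ->
  int_Omega x0 y0 (fun z => r * f z) = r * int_Omega x0 y0 f.
Proof. exact: (RintegralZl r (measurable_Omega x0 y0)). Qed.

(** The product f g has a partial derivative whose integral is a boundary
    term. *)
Lemma int_Omega_parts1 f g : smooth f -> smooth g ->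
  int_Omega x0 y0 (fun z => f z * partial1 g z) =
  \int[@leb1 R]_(y in `[0, y0]) (f (x0, y) * g (x0, y) - f (0, y) * g (0, y))
  - int_Omega x0 y0 (fun z => partial1 f z * g z).
Proof.
move=> sf sg; have sfg := smoothM sf sg.
rewrite -(@int_Omega_partial1 _ x0 y0 hx0 (f \* g)).
- rewrite partial1M// int_OmegaD ?addrK//; apply: integrable_OmegaM;
    apply: smooth_L2 => //; exact: smooth_partial1.
- exact: smooth_continuous.
- exact: smooth_derivable1.
- exact/smooth_continuous/smooth_partial1.
Qed.

Lemma int_Omega_parts2 f g : smooth f -> smooth g ->
  int_Omega x0 y0 (fun z => f z * partial2 g z) =
  \int[@leb1 R]_(x in `[0, x0]) (f (x, y0) * g (x, y0) - f (x, 0) * g (x, 0))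
  - int_Omega x0 y0 (fun z => partial2 f z * g z).
Proof.
move=> sf sg; have sfg := smoothM sf sg.
rewrite -(@int_Omega_partial2 _ x0 y0 hy0 (f \* g)).
- rewrite partial2M// int_OmegaD ?addrK//; apply: integrable_OmegaM;
    apply: smooth_L2 => //; exact: smooth_partial2.
- exact: smooth_continuous.
- exact: smooth_derivable2.
- exact/smooth_continuous/smooth_partial2.
Qed.

(** A test function vanishes on the boundary of the rectangle, which kills the
    boundary term of the integration by parts. *)
Lemma smooth_weak_partial1 f : smooth f -> weak_partial Om (@partial1 R) f (partial1 f).
Proof.
move=> sf phi tphi; have [sphi _ _] := tphi.
have := int_Omega_parts1 sf sphi; rewrite /int_Omega => ->.
rewrite [X in X - _](_ : _ = 0) ?sub0r//.
rewrite -[RHS](mul0r (fine (@leb1 R `[0, y0]))) -Rintegral_cst//.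
apply: eq_Rintegral => y _; rewrite !(test_function_out tphi) ?mulr0 ?subrr//.
- by move=> [/=]; rewrite in_itv/= ltxx.
- by move=> [/=]; rewrite in_itv/= ltxx andbF.
Qed.

Lemma smooth_weak_partial2 f : smooth f -> weak_partial Om (@partial2 R) f (partial2 f).
Proof.
move=> sf phi tphi; have [sphi _ _] := tphi.
have := int_Omega_parts2 sf sphi; rewrite /int_Omega => ->.
rewrite [X in X - _](_ : _ = 0) ?sub0r//.
rewrite -[RHS](mul0r (fine (@leb1 R `[0, x0]))) -Rintegral_cst//.
apply: eq_Rintegral => x _; rewrite !(test_function_out tphi) ?mulr0 ?subrr//.
- by move=> [_ /=]; rewrite in_itv/= ltxx.
- by move=> [_ /=]; rewrite in_itv/= ltxx andbF.
Qed.

Lemma weak_partialB partial v w f g :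
  (forall phi, smooth phi -> smooth (partial phi)) ->
  sqiO v -> sqiO w -> sqiO f -> sqiO g ->
  weak_partial Om partial v w -> weak_partial Om partial f g ->
  weak_partial Om partial (v \- f) (w \- g).
Proof.
move=> sp sv sw sf sg vw fg phi tphi; have [sphi _ _] := tphi.
have sphi2 := smooth_L2 sphi; have sdphi2 := smooth_L2 (sp _ sphi).
have := @int_OmegaB _ _ (integrable_OmegaM sv sdphi2) (integrable_OmegaM sf sdphi2).
have := @int_OmegaB _ _ (integrable_OmegaM sw sphi2) (integrable_OmegaM sg sphi2).
rewrite /int_Omega vw// fg// => Ewg Evf.
under eq_Rintegral do rewrite mulrBl.
rewrite Evf; under [in RHS]eq_Rintegral do rewrite mulrBl.
by rewrite Ewg opprB addrC opprK.
Qed.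

Definition H1_smooth f (sf : smooth f) : H1 x0 y0 :=
  MkH1 (smooth_L2 sf) (smooth_L2 (smooth_partial1 sf))
    (smooth_L2 (smooth_partial2 sf))
    (smooth_weak_partial1 sf) (smooth_weak_partial2 sf).

Definition H1_sub (u v : H1 x0 y0) : H1 x0 y0 :=
  let mO := measurable_Omega x0 y0 in
  MkH1 (L2B mO (H1fun_L2 u) (H1fun_L2 v))
    (L2B mO (H1dx_L2 u) (H1dx_L2 v)) (L2B mO (H1dy_L2 u) (H1dy_L2 v))
    (weak_partialB smooth_partial1 (H1fun_L2 u) (H1dx_L2 u) (H1fun_L2 v) (H1dx_L2 v)
       (H1dxP u) (H1dxP v))
    (weak_partialB smooth_partial2 (H1fun_L2 u) (H1dy_L2 u) (H1fun_L2 v) (H1dy_L2 v)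
       (H1dyP u) (H1dyP v)).

End Smooth.

(** * Traces: Green's formula and the Poincare inequality *)

Section Trace.
Variables (R : realType) (x0 y0 : R).
Hypotheses (hx0 : 0 < x0) (hy0 : 0 < y0).
Implicit Types (u v w : H1 x0 y0) (t s f : R * R -> R).
Notation Om := (Omega x0 y0).
Notation H1_smooth sf := (@H1_smooth R x0 y0 hx0 hy0 _ sf).

Let mO := measurable_Omega x0 y0.
Let mI (l : R) : measurable (`[0, l]%classic : set (measurableTypeR R)) :=
  measurable_itv `[0, l].

Lemma L2_cvg_cst d (T : measurableType d) (mu : {measure set T -> \bar R})
  (D : set T) (f : T -> R) : L2_cvg mu D (fun=> f) f.
Proof.
rewrite /L2_cvg.
under [X in X @ _]funext do under eq_integral do rewrite subrr expr0n/=.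
by under [X in X @ _]funext do rewrite integral0; exact: cvg_cst.
Qed.

Lemma trace_smooth f (sf : smooth f) : trace (H1_smooth sf) f.
Proof.
exists (fun=> f); split => //; first by split; exact: L2_cvg_cst.
all: split; split; try exact: L2_cvg_cst.
1,2: by apply: continuous_itv_L2; apply: continuous_yslice; exact: smooth_continuous.
all: by apply: continuous_itv_L2; apply: continuous_xslice; exact: smooth_continuous.
Qed.

Lemma L2_cvgB d (T : measurableType d) (mu : {measure set T -> \bar R})
  (D : set T) (f : nat -> T -> R) (g h : T -> R) :
  L2_cvg mu D f g -> L2_cvg mu D (fun n x => f n x - h x) (fun x => g x - h x).
Proof.
rewrite /L2_cvg.
suff -> : (fun n => \int[mu]_(x in D) ((f n x - h x - (g x - h x)) ^+ 2)%:E)%E =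
  (fun n => \int[mu]_(x in D) ((f n x - g x) ^+ 2)%:E)%E by [].
apply/funext => n; apply: eq_integral => x _.
by rewrite opprB addrA subrK.
Qed.

(** If f_n approximates u then f_n - f approximates u - f, with the very same
    errors. *)
Lemma trace_sub_smooth u t f (sf : smooth f) :
  trace u t -> trace (H1_sub u (H1_smooth sf)) (fun z => t z - f z).
Proof.
move=> [fn [sfn [c0 c1 c2] [e1 e2] [e3 e4]]].
exists (fun n => fn n \- f); split.
- by move=> n; exact: smoothB.
- split; first exact: L2_cvgB.
  + under [X in L2_cvg _ _ X]funext do rewrite partial1B//.
    exact: L2_cvgB.
  + under [X in L2_cvg _ _ X]funext do rewrite partial2B//.
    exact: L2_cvgB.
- split.
  + case: e1 => sq cv; split; last exact: (L2_cvgB (f \o _)).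
    apply: L2B => //; apply: continuous_itv_L2; apply: continuous_yslice.
    exact: smooth_continuous.
  + case: e2 => sq cv; split; last exact: (L2_cvgB (f \o _)).
    apply: L2B => //; apply: continuous_itv_L2; apply: continuous_yslice.
    exact: smooth_continuous.
- split.
  + case: e3 => sq cv; split; last exact: (L2_cvgB (f \o _)).
    apply: L2B => //; apply: continuous_itv_L2; apply: continuous_xslice.
    exact: smooth_continuous.
  + case: e4 => sq cv; split; last exact: (L2_cvgB (f \o _)).
    apply: L2B => //; apply: continuous_itv_L2; apply: continuous_xslice.
    exact: smooth_continuous.
Qed.

Lemma trace_Gamma1_L2 u t : trace u t ->
  square_integrable (@leb1 R) `[0, y0] (fun y => t (0, y)).
Proof. by case=> ? [_ _ [[]]]. Qed.

Lemma trace_Gamma2_L2 u t : trace u t ->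
  square_integrable (@leb1 R) `[0, y0] (fun y => t (x0, y)).
Proof. by case=> ? [_ _ [_ []]]. Qed.

Lemma cst_itv_L2 (c : R) : square_integrable (@leb1 R) `[0, y0] (fun=> c).
Proof. by apply: continuous_itv_L2; exact: cst_continuous. Qed.

Lemma L2_itv_integrable (h : R -> R) : square_integrable (@leb1 R) `[0, y0] h ->
  (@leb1 R).-integrable `[0, y0] (EFin \o h).
Proof.
move=> sh; have := L2_mul_integrable (mI y0) sh (cst_itv_L2 1).
by under [X in _.-integrable _ (EFin \o X)]funext do rewrite mulr1.
Qed.

(** Green's formula for the vector field (Q(x), 0): integrate by parts along a
    smooth sequence defining the trace, and pass to the limit. *)
Lemma H1_Green (Q : {poly R}) v s : trace v s ->
  int_Omega x0 y0 (fun z => xpoly Q z * H1dx v z) =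
  Q.[x0] * int_Gamma2 x0 y0 s - Q.[0] * int_Gamma1 y0 s
  - int_Omega x0 y0 (fun z => xpoly Q^`() z * v z).
Proof.
move=> [f [sf [c0 c1 _] [[sq1 e1] [sq2 e2]] _]].
have sQ := smooth_xpoly Q; have sdQ := smooth_xpoly Q^`().
have sfx1 n : square_integrable (@leb1 R) `[0, y0] (fun y => f n (0, y)).
  by apply: continuous_itv_L2; apply: continuous_yslice; exact: smooth_continuous.
have sfx2 n : square_integrable (@leb1 R) `[0, y0] (fun y => f n (x0, y)).
  by apply: continuous_itv_L2; apply: continuous_yslice; exact: smooth_continuous.
have lhs := L2_cvg_Rintegral mO (fun n => smooth_L2 x0 y0 (smooth_partial1 (sf n)))
  (H1dx_L2 v) (smooth_L2 x0 y0 sQ) c1.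
have rhs := L2_cvg_Rintegral mO (fun n => smooth_L2 x0 y0 (sf n))
  (H1fun_L2 v) (smooth_L2 x0 y0 sdQ) c0.
have r1 := L2_cvg_Rintegral (mI y0) sfx1 sq1 (cst_itv_L2 Q.[0]) e1.
have r2 := L2_cvg_Rintegral (mI y0) sfx2 sq2 (cst_itv_L2 Q.[x0]) e2.
have r := cvgB (cvgB r2 r1) rhs.
rewrite /int_Omega /int_Gamma1 /int_Gamma2 -!RintegralZl//;
  [|exact: L2_itv_integrable..].
apply: (cvg_unique (@norm_hausdorff _ _) lhs).
suff -> : (fun n => \int[@leb2 R]_(z in Om) (xpoly Q z * partial1 (f n) z)) =
  (fun n => \int[@leb1 R]_(y in `[0, y0]) (Q.[x0] * f n (x0, y)) -
    \int[@leb1 R]_(y in `[0, y0]) (Q.[0] * f n (0, y)) -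
    \int[@leb2 R]_(z in Om) (xpoly Q^`() z * f n z)) by exact: r.
apply/funext => n.
have := int_Omega_parts1 y0 hx0 sQ (sf n); rewrite /int_Omega => ->.
rewrite partial1_xpoly RintegralB//.
- exact: (L2_mul_integrable (mI y0) (cst_itv_L2 Q.[x0]) (sfx2 n)).
- exact: (L2_mul_integrable (mI y0) (cst_itv_L2 Q.[0]) (sfx1 n)).
Qed.

(** The weight h = x0 - x vanishes on Gamma2, so integrating d(h f^2)/dx leaves
    only the edge Gamma1:
    int f^2 = x0 int_Gamma1 f^2 + 2 int h f (df/dx). Since 0 <= h <= x0, the last
    term is at most (1/2) int f^2 + 2 x0^2 int (df/dx)^2, and half of int f^2 is
    absorbed on the left. *)
Lemma Poincare_smooth f : smooth f ->
  int_Omega x0 y0 (fun z => f z ^+ 2) <=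
  2 * x0 * int_Gamma1 y0 (fun z => f z ^+ 2)
  + 4 * x0 ^+ 2 * int_Omega x0 y0 (fun z => partial1 f z ^+ 2).
Proof.
move=> sf; pose h := xpoly (x0%:P - 'X).
have sh : smooth h by exact: smooth_xpoly.
have shf := smoothM sh sf; have sdf := smooth_partial1 sf.
have hE z : h z = x0 - z.1 by rewrite /h /xpoly !hornerE.
have dhE z : partial1 h z = -1.
  by rewrite /h partial1_xpoly /xpoly derivB derivC derivX !hornerE.
have parts := int_Omega_parts1 y0 hx0 shf sf.
have E1 : \int[@leb1 R]_(y in `[0, y0])
    ((h \* f) (x0, y) * f (x0, y) - (h \* f) (0, y) * f (0, y)) =
    - (x0 * int_Gamma1 y0 (fun z => f z ^+ 2)).
  rewrite -mulNr -RintegralZl//.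
    by apply: eq_Rintegral => y _ /=; rewrite !hE/=; ring.
  apply: L2_sqr_integrable; apply: continuous_itv_L2; apply: continuous_yslice.
  exact: smooth_continuous.
have if2 := L2_sqr_integrable (smooth_L2 x0 y0 sf).
have idf2 := L2_sqr_integrable (smooth_L2 x0 y0 sdf).
have ihfdf := integrable_OmegaM (smooth_L2 x0 y0 shf) (smooth_L2 x0 y0 sdf).
have E2 : int_Omega x0 y0 (fun z => partial1 (h \* f) z * f z) =
    int_Omega x0 y0 (fun z => (h \* f) z * partial1 f z)
    - int_Omega x0 y0 (fun z => f z ^+ 2).
  rewrite -int_OmegaB//; apply: eq_Rintegral => z _.
  by rewrite partial1M// dhE/=; ring.
have E3 : 2 * int_Omega x0 y0 (fun z => (h \* f) z * partial1 f z) <=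
    2^-1 * int_Omega x0 y0 (fun z => f z ^+ 2) +
    2 * x0 ^+ 2 * int_Omega x0 y0 (fun z => partial1 f z ^+ 2).
  rewrite -!int_OmegaZ// -int_OmegaD//.
  - apply: le_Rintegral => //.
    + exact: integrable_EFinZl.
    + apply: (@integrableD _ _ _ _ _ mO (fun z => (2^-1 * f z ^+ 2)%:E)
        (fun z => (2 * x0 ^+ 2 * partial1 f z ^+ 2)%:E)).
      * exact: integrable_EFinZl.
      * exact: integrable_EFinZl.
    + move=> [x y] [/= + _]; rewrite in_itv/= hE/= => /andP[x_gt0 x_lt].
      have := sqr_ge0 (f (x, y) - 2 * (x0 - x) * partial1 f (x, y)).
      have : (x0 - x) ^+ 2 * partial1 f (x, y) ^+ 2 <= x0 ^+ 2 * partial1 f (x, y) ^+ 2.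
        by rewrite ler_wpM2r ?sqr_ge0// lerXn2r ?nnegrE; lra.
      by nra.
  - exact: integrable_EFinZl.
  - exact: integrable_EFinZl.
move: parts; rewrite E1 E2; lra.
Qed.

Lemma Poincare_trace w t : trace w t ->
  int_Omega x0 y0 (fun z => w z ^+ 2) <=
  2 * x0 * int_Gamma1 y0 (fun z => t z ^+ 2)
  + 4 * x0 ^+ 2 * int_Omega x0 y0 (fun z => H1dx w z ^+ 2).
Proof.
move=> [f [sf [c0 c1 _] [[sq1 e1] _] _]].
have sfx1 n : square_integrable (@leb1 R) `[0, y0] (fun y => f n (0, y)).
  by apply: continuous_itv_L2; apply: continuous_yslice; exact: smooth_continuous.
have l0 := L2_cvg_Rintegral_sqr mO (fun n => smooth_L2 x0 y0 (sf n)) (H1fun_L2 w) c0.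
have l1 := L2_cvg_Rintegral_sqr mO (fun n => smooth_L2 x0 y0 (smooth_partial1 (sf n)))
  (H1dx_L2 w) c1.
have l2 := L2_cvg_Rintegral_sqr (mI y0) sfx1 sq1 e1.
apply: ler_cvg_to l0
  (cvgD (cvgM (cvg_cst (2 * x0)) l2) (cvgM (cvg_cst (4 * x0 ^+ 2)) l1)) _.
by apply: nearW => n; exact: Poincare_smooth.
Qed.

End Trace.

(** * Uniqueness, and the energy identities of the explicit solutions *)

Section Problems.
Variables (R : realType) (x0 y0 : R).
Hypotheses (hx0 : 0 < x0) (hy0 : 0 < y0).
Implicit Types (u v w : H1 x0 y0) (t s f : R * R -> R) (P : {poly R}).
Notation Om := (Omega x0 y0).
Notation H1_smooth sf := (@H1_smooth R x0 y0 hx0 hy0 _ sf).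
Notation H1_xpoly P := (H1_smooth (smooth_xpoly P)).

Let mO := measurable_Omega x0 y0.
Let mI : measurable (`[0, y0]%classic : set (measurableTypeR R)) :=
  measurable_itv `[0, y0].

Lemma int_grad_grad_integrable u v :
  (@leb2 R).-integrable Om
    (EFin \o (fun z => H1dx u z * H1dx v z + H1dy u z * H1dy v z)).
Proof.
apply: (@integrableD _ _ _ _ _ mO (fun z => (H1dx u z * H1dx v z)%:E)
  (fun z => (H1dy u z * H1dy v z)%:E)).
- exact: integrable_OmegaM (H1dx_L2 u) (H1dx_L2 v).
- exact: integrable_OmegaM (H1dy_L2 u) (H1dy_L2 v).
Qed.

Lemma int_grad_gradB u u' v :
  int_grad_grad (H1_sub u u') v = int_grad_grad u v - int_grad_grad u' v.
Proof.
rewrite /int_grad_grad -int_OmegaB; [|exact: int_grad_grad_integrable..].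
by apply: eq_Rintegral => z _ /=; ring.
Qed.

Lemma int_grad_grad_ge0 u : 0 <= int_grad_grad u u.
Proof. by apply: Rintegral_ge0 => z _; rewrite -!expr2 addr_ge0 ?sqr_ge0. Qed.

(** The uniqueness principle of all four problems: an element of H^1 without
    energy and without trace on Gamma1 vanishes. *)
Lemma H1_eq0 w t : trace w t ->
  int_grad_grad w w <= 0 -> int_Gamma1 y0 (fun z => t z ^+ 2) <= 0 ->
  ae_eq (@leb2 R) Om w (cst 0).
Proof.
move=> wt dw0 t0; apply: (Rintegral_sqr_eq0 mO (H1fun_L2 w)).
apply/le_anti/andP; split; last by apply: Rintegral_ge0 => z _; exact: sqr_ge0.
have dx0 : int_Omega x0 y0 (fun z => H1dx w z ^+ 2) <= 0.
  apply: le_trans dw0; apply: le_Rintegral => //.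
  - by have [] := H1dx_L2 w.
  - exact: int_grad_grad_integrable.
  - by move=> z _ /=; rewrite -!expr2 lerDl sqr_ge0.
apply: le_trans (Poincare_trace hx0 wt) _.
by rewrite -[leRHS]addr0 lerD// mulr_ge0_le0// mulr_ge0 ?sqr_ge0// ltW.
Qed.

Lemma H1_sub_eq0 u f (sf : smooth f) :
  ae_eq (@leb2 R) Om (H1_sub u (H1_smooth sf)) (cst 0) -> ae_eq (@leb2 R) Om u f.
Proof. by apply: filterS => z /= /[apply] /eqP; rewrite subr_eq0 => /eqP. Qed.

Lemma ae0_int_Gamma1 (h : R * R -> R) :
  measurable_fun (`[0, y0]%classic : set (measurableTypeR R)) (fun y => h (0, y)) ->
  cst_on_Gamma1 y0 h 0 -> int_Gamma1 y0 h = 0.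
Proof.
move=> mh h0; rewrite /int_Gamma1.
rewrite (ae_eq_Rintegral mI mh (measurable_cst (0 : R)) h0).
by rewrite Rintegral_cst// mul0r.
Qed.

(** The difference w = u - f has zero trace on Gamma1, hence is itself an
    admissible test function: its energy is zero. *)
Lemma Dirichlet_unique u t f (c : R) (sf : smooth f) :
  trace u t -> cst_on_Gamma1 y0 t c -> (forall y, f (0, y) = c) ->
  (forall v s, trace v s -> cst_on_Gamma1 y0 s 0 ->
     int_grad_grad u v = int_grad_grad (H1_smooth sf) v) ->
  ae_eq (@leb2 R) Om u f.
Proof.
move=> ut tc fc uE; apply: (@H1_sub_eq0 _ _ sf).
have wt := trace_sub_smooth hx0 hy0 sf ut.
have t0 : cst_on_Gamma1 y0 (fun z => t z - f z) 0.
  by move: tc; apply: filterS => y /[apply] /= ->; rewrite fc subrr.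
apply: (H1_eq0 wt); first by rewrite int_grad_gradB (uE _ _ wt t0) subrr.
rewrite ae0_int_Gamma1//.
- by apply: measurable_funX; have [] := trace_Gamma1_L2 wt.
- by move: t0; apply: filterS => y /[apply] /= ->; rewrite expr0n.
Qed.

Lemma Robin_integrable u t v s (alpha b : R) : trace u t -> trace v s ->
  (@leb1 R).-integrable `[0, y0] (EFin \o (fun y => alpha * (t (0, y) - b) * s (0, y))).
Proof.
move=> ut vs.
have tb := L2B mI (trace_Gamma1_L2 ut) (cst_itv_L2 y0 b).
have tbs := L2_mul_integrable mI tb (trace_Gamma1_L2 vs).
under [X in _.-integrable _ (EFin \o X)]funext do rewrite -mulrA.
exact: integrable_EFinZl.
Qed.

(** Testing both equations with w = u - f, whose trace on Gamma1 is t - f, and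
    subtracting: int |grad w|^2 + alpha int_Gamma1 (t - f)^2 = 0, a sum of two
    nonnegative terms. *)
Lemma Robin_unique u t f (alpha b : R) (sf : smooth f) : 0 < alpha -> trace u t ->
  (forall v s, trace v s ->
     int_grad_grad u v + int_Gamma1 y0 (fun z => alpha * (t z - b) * s z) =
     int_grad_grad (H1_smooth sf) v
     + int_Gamma1 y0 (fun z => alpha * (f z - b) * s z)) ->
  ae_eq (@leb2 R) Om u f.
Proof.
move=> alpha_gt0 ut uE; apply: (@H1_sub_eq0 _ _ sf).
have wt := trace_sub_smooth hx0 hy0 sf ut.
have ft := trace_smooth hx0 hy0 sf.
set w := H1_sub u (H1_smooth sf) in wt *.
have energy : int_grad_grad w w
    + alpha * int_Gamma1 y0 (fun z => (t z - f z) ^+ 2) = 0.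
  have E : alpha * int_Gamma1 y0 (fun z => (t z - f z) ^+ 2) =
      int_Gamma1 y0 (fun z => alpha * (t z - b) * (t z - f z))
      - int_Gamma1 y0 (fun z => alpha * (f z - b) * (t z - f z)).
    rewrite /int_Gamma1 -RintegralB//;
      [|exact: Robin_integrable ut wt|exact: Robin_integrable ft wt].
    rewrite -RintegralZl//; last by have [] := trace_Gamma1_L2 wt.
    by apply: eq_Rintegral => y _; ring.
  by rewrite E int_grad_gradB; have := uE _ _ wt; lra.
have g0 := int_grad_grad_ge0 w.
have G0 : 0 <= int_Gamma1 y0 (fun z => (t z - f z) ^+ 2).
  by apply: Rintegral_ge0 => y _; exact: sqr_ge0.
by apply: (H1_eq0 wt); nra.
Qed.

Lemma int_grad_grad_xpoly P v s : trace v s ->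
  int_grad_grad (H1_xpoly P) v =
  P^`().[x0] * int_Gamma2 x0 y0 s - P^`().[0] * int_Gamma1 y0 s
  - int_Omega x0 y0 (fun z => xpoly P^`()^`() z * v z).
Proof.
move=> vs; rewrite -(H1_Green hx0 _ vs).
apply: eq_Rintegral => z _ /=.
by rewrite partial1_xpoly partial2_xpoly /xpoly horner0 mul0r addr0.
Qed.

(** The solution U of -U'' = g, U'(x0) = - q, U(0) = c. The condition on Gamma1
    only selects c. *)
Definition state_poly (g q c : R) : {poly R} :=
  (- (g / 2)) *: 'X^2 + (g * x0 - q) *: 'X + c%:P.

(** The value at 0 of the derivative of the adjoint state, determined by the
    condition P'(x0) = 0. It is the constant A for c = b, and A_alpha for
    c = b + (g x0 - q) / alpha. *)
Definition adjoint_slope (g q c zd : R) : R :=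
  x0 * (g * (x0 ^+ 2 / 3) - q * (x0 / 2) + (c - zd)).

(** The solution P of -P'' = U - zd, P'(x0) = 0, P(0) = d, where U is
    [state_poly g q c]. *)
Definition adjoint_poly (g q c zd d : R) : {poly R} :=
  (g / 24) *: 'X^4 - ((g * x0 - q) / 6) *: 'X^3 - ((c - zd) / 2) *: 'X^2
  + adjoint_slope g q c zd *: 'X + d%:P.

Lemma state_energy g q c v s : trace v s ->
  int_grad_grad (H1_xpoly (state_poly g q c)) v =
  int_Omega x0 y0 (fun z => g * v z) - int_Gamma2 x0 y0 (fun z => q * s z)
  - (g * x0 - q) * int_Gamma1 y0 s.
Proof.
move=> vs; rewrite (int_grad_grad_xpoly _ vs).
have dE x : (state_poly g q c)^`().[x] = - g * x + (g * x0 - q).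
  by rewrite /state_poly !poly.derivE !hornerE/=; field.
have ddE x : (state_poly g q c)^`()^`().[x] = - g.
  by rewrite /state_poly !poly.derivE !hornerE/=; field.
have iv : (@leb2 R).-integrable Om (EFin \o v).
  have := integrable_OmegaM (H1fun_L2 v) (smooth_L2 x0 y0 (smooth_xpoly 1)).
  by under [X in _.-integrable _ (EFin \o X)]funext do rewrite /xpoly hornerC mulr1.
rewrite {1}/int_Omega; under eq_Rintegral do rewrite /xpoly ddE.
rewrite [X in _ - X](int_OmegaZ (- g) iv) (int_OmegaZ g iv) !dE.
rewrite {2}/int_Gamma2 RintegralZl//;
  last exact: L2_itv_integrable (trace_Gamma2_L2 vs).
by rewrite /int_Gamma2; ring.
Qed.

Lemma adjoint_energy g q c zd d v s : trace v s ->
  int_grad_grad (H1_xpoly (adjoint_poly g q c zd d)) v =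
  int_Omega x0 y0 (fun z => (xpoly (state_poly g q c) z - zd) * v z)
  - adjoint_slope g q c zd * int_Gamma1 y0 s.
Proof.
move=> vs; rewrite (int_grad_grad_xpoly _ vs).
have dE x : (adjoint_poly g q c zd d)^`().[x] =
  g * x ^+ 3 / 6 - (g * x0 - q) * x ^+ 2 / 2 - (c - zd) * x + adjoint_slope g q c zd.
  by rewrite /adjoint_poly !poly.derivE !hornerE/=; field.
have ddE x : (adjoint_poly g q c zd d)^`()^`().[x] = - ((state_poly g q c).[x] - zd).
  by rewrite /adjoint_poly /state_poly !poly.derivE !hornerE/=; field.
rewrite !dE [_ * x0 ^+ 3 / 6 - _ - _ + _](_ : _ = 0) ?mul0r ?sub0r; last first.
  by rewrite /adjoint_slope; field.
rewrite [g * 0 ^+ 3 / 6 - _ - _ + _](_ : _ = adjoint_slope g q c zd); last by field.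
rewrite addrC -mulN1r -int_OmegaZ; last first.
  exact: integrable_OmegaM (smooth_L2 x0 y0 (smooth_xpoly _)) (H1fun_L2 v).
congr (_ + _); apply: eq_Rintegral => z _.
by rewrite /xpoly ddE mulN1r mulNr opprK.
Qed.

End Problems.

(** * Solving the four problems *)

Section Solutions.
Variables (R : realType) (x0 y0 : R).
Hypotheses (hx0 : 0 < x0) (hy0 : 0 < y0).
Variables (g q b zd alpha : R).
Hypothesis alpha_gt0 : 0 < alpha.
Implicit Types (u v p : H1 x0 y0) (t s f : R * R -> R) (P : {poly R}).
Notation Om := (Omega x0 y0).
Notation H1_xpoly P := (H1_smooth hx0 hy0 (smooth_xpoly P)).
Notation state c := (state_poly x0 g q c).
Notation adjoint c d := (adjoint_poly x0 g q c zd d).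
Notation slope c := (adjoint_slope x0 g q c zd).

(* The Robin condition U'(0) = alpha (U(0) - b) with U'(0) = g x0 - q. *)
Let balpha := (g * x0 - q) / alpha + b.

Let trace_xpoly P : trace (H1_xpoly P) (xpoly P).
Proof. exact: trace_smooth. Qed.

Lemma cst_on_Gamma1_xpoly P (c : R) : P.[0] = c -> cst_on_Gamma1 y0 (xpoly P) c.
Proof. by move=> P0; apply: aeW => y _; rewrite /xpoly/= P0. Qed.

Lemma state_poly0 c : (state c).[0] = c.
Proof. by rewrite /state_poly !hornerE/=; ring. Qed.

Lemma adjoint_poly0 c d : (adjoint c d).[0] = d.
Proof. by rewrite /adjoint_poly !hornerE/=; ring. Qed.

Lemma int_Omega_state_misfit u P v : ae_eq (@leb2 R) Om u (xpoly P) ->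
  int_Omega x0 y0 (fun z => (u z - zd) * v z) =
  int_Omega x0 y0 (fun z => (xpoly P z - zd) * v z).
Proof.
move=> uP; have [mu _] := H1fun_L2 u; have [mv _] := H1fun_L2 v.
have [mP _] := smooth_L2 x0 y0 (smooth_xpoly P).
apply: (ae_eq_Rintegral (measurable_Omega x0 y0)).
- exact: measurable_funM (measurable_funB mu (measurable_cst zd)) mv.
- exact: measurable_funM (measurable_funB mP (measurable_cst zd)) mv.
- by move: uP; apply: filterS => z /[apply] ->.
Qed.

Lemma is_state_xpoly : is_state g q b (H1_xpoly (state b)).
Proof.
split; first by exists (xpoly (state b)) => //; exact/cst_on_Gamma1_xpoly/state_poly0.
move=> v s vs s0; rewrite (state_energy hx0 hy0 _ _ _ vs).
by rewrite (ae0_int_Gamma1 _ s0) ?mulr0 ?subr0//; have [] := trace_Gamma1_L2 vs.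
Qed.

Lemma is_state_ae_eq u : is_state g q b u ->
  ae_eq (@leb2 R) Om u (xpoly (state b)).
Proof.
move=> [[t ut tb] uE].
apply: (Dirichlet_unique (hx0 := hx0) (hy0 := hy0)
  (sf := smooth_xpoly (state b)) ut tb).
  by move=> y; exact: state_poly0.
have [_ UE] := is_state_xpoly => v s vs s0.
by rewrite (uE _ _ vs s0) (UE _ _ vs s0).
Qed.

(** Only the class of u modulo equality almost everywhere matters: for u equal to
    the explicit state this is existence, and for an arbitrary solution u it is
    the comparison needed for uniqueness. *)
Lemma is_adjoint_xpoly u : ae_eq (@leb2 R) Om u (xpoly (state b)) ->
  is_adjoint zd u (H1_xpoly (adjoint b 0)).
Proof.
move=> uE; split.
  by exists (xpoly (adjoint b 0)) => //; exact/cst_on_Gamma1_xpoly/adjoint_poly0.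
move=> v s vs s0; rewrite (adjoint_energy hx0 hy0 _ _ _ _ _ vs).
rewrite (int_Omega_state_misfit _ uE) (ae0_int_Gamma1 _ s0) ?mulr0 ?subr0//.
by have [] := trace_Gamma1_L2 vs.
Qed.

Lemma is_adjoint_ae_eq u p : ae_eq (@leb2 R) Om u (xpoly (state b)) ->
  is_adjoint zd u p -> ae_eq (@leb2 R) Om p (xpoly (adjoint b 0)).
Proof.
move=> uE [[t pt t0] pE].
apply: (Dirichlet_unique (hx0 := hx0) (hy0 := hy0)
  (sf := smooth_xpoly (adjoint b 0)) pt t0).
  by move=> y; exact: adjoint_poly0.
have [_ PE] := is_adjoint_xpoly uE => v s vs s0.
by rewrite (pE _ _ vs s0) (PE _ _ vs s0).
Qed.

Lemma Robin_xpoly P v s (c : R) : trace v s ->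
  int_Gamma1 y0 (fun z => alpha * (xpoly P z - c) * s z) =
  alpha * (P.[0] - c) * int_Gamma1 y0 s.
Proof.
move=> vs; rewrite /int_Gamma1 -RintegralZl//.
exact: L2_itv_integrable (trace_Gamma1_L2 vs).
Qed.

Lemma Robin0 t s : int_Gamma1 y0 (fun z => alpha * t z * s z) =
  int_Gamma1 y0 (fun z => alpha * (t z - 0) * s z).
Proof. by apply: eq_Rintegral => y _; rewrite subr0. Qed.

Lemma is_state_alpha_xpoly : is_state_alpha g q b alpha (H1_xpoly (state balpha)).
Proof.
exists (xpoly (state balpha)) => // v s vs.
rewrite (state_energy hx0 hy0 _ _ _ vs) (Robin_xpoly _ _ vs) state_poly0.
have -> : alpha * (balpha - b) = g * x0 - q by rewrite /balpha; field; rewrite gt_eqF.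
by rewrite subrK.
Qed.

Lemma is_state_alpha_ae_eq u : is_state_alpha g q b alpha u ->
  ae_eq (@leb2 R) Om u (xpoly (state balpha)).
Proof.
move=> [t ut uE]; apply: (Robin_unique (b := b) (hx0 := hx0) (hy0 := hy0)
  (sf := smooth_xpoly (state balpha)) alpha_gt0 ut).
move=> v s vs; rewrite (uE _ _ vs) (state_energy hx0 hy0 _ _ _ vs).
rewrite (Robin_xpoly _ _ vs) state_poly0.
have -> : alpha * (balpha - b) = g * x0 - q by rewrite /balpha; field; rewrite gt_eqF.
by rewrite subrK.
Qed.

Lemma is_adjoint_alpha_xpoly u : ae_eq (@leb2 R) Om u (xpoly (state balpha)) ->
  is_adjoint_alpha zd alpha u (H1_xpoly (adjoint balpha (slope balpha / alpha))).
Proof.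
move=> uE; exists (xpoly (adjoint balpha (slope balpha / alpha))) => // v s vs.
rewrite (adjoint_energy hx0 hy0 _ _ _ _ _ vs) (int_Omega_state_misfit _ uE).
rewrite Robin0 (Robin_xpoly _ _ vs) adjoint_poly0 subr0.
by rewrite mulrCA divff ?mulr1 ?subrK// gt_eqF.
Qed.

Lemma is_adjoint_alpha_ae_eq u p : ae_eq (@leb2 R) Om u (xpoly (state balpha)) ->
  is_adjoint_alpha zd alpha u p ->
  ae_eq (@leb2 R) Om p (xpoly (adjoint balpha (slope balpha / alpha))).
Proof.
move=> uE [t pt pE].
apply: (Robin_unique (b := 0) (hx0 := hx0) (hy0 := hy0)
  (sf := smooth_xpoly (adjoint balpha (slope balpha / alpha))) alpha_gt0 pt).
move=> v s vs; rewrite -Robin0 (pE _ _ vs).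
rewrite (adjoint_energy hx0 hy0 _ _ _ _ _ vs) (int_Omega_state_misfit _ uE).
rewrite (Robin_xpoly _ _ vs) adjoint_poly0 subr0.
by rewrite mulrCA divff ?mulr1 ?subrK// gt_eqF.
Qed.

End Solutions.

Theorem lemma2p1 (R : realType) (x0 y0 g q b zd alpha : R)
    (hx0 : 0 < x0) (hy0 : 0 < y0) (halpha : 0 < alpha) :
  (exists u p ualpha palpha : H1 x0 y0,
     [/\ is_state g q b u, is_adjoint zd u p,
         is_state_alpha g q b alpha ualpha &
         is_adjoint_alpha zd alpha ualpha palpha]) /\
  (forall u p ualpha palpha : H1 x0 y0,
     is_state g q b u -> is_adjoint zd u p ->
     is_state_alpha g q b alpha ualpha ->
     is_adjoint_alpha zd alpha ualpha palpha ->
     let A := x0 * (g * (x0 ^+ 2 / 3) - q * (x0 / 2) + (b - zd)) in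
     let Aalpha :=
       x0 * (g * x0 ^+ 2 * (1 / 3 + 1 / (alpha * x0))
             - q * x0 * (1 / 2 + 1 / (alpha * x0)) + (b - zd)) in
     (ae_eq (@leb2 R) (Omega x0 y0) u
        (fun z => let x := z.1 in
           - g * (x ^+ 2 / 2) + (g * x0 - q) * x + b) /\
      ae_eq (@leb2 R) (Omega x0 y0) p
        (fun z => let x := z.1 in
           g * (x ^+ 4 / 24) - (g * x0 - q) * (x ^+ 3 / 6)
           - (b - zd) * (x ^+ 2 / 2) + A * x)) /\
     (ae_eq (@leb2 R) (Omega x0 y0) ualpha
        (fun z => let x := z.1 in
           - g * (x ^+ 2 / 2) + (g * x0 - q) * x + (g * x0 - q) / alpha + b) /\
      ae_eq (@leb2 R) (Omega x0 y0) palpha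
        (fun z => let x := z.1 in
           g * (x ^+ 4 / 24) - (g * x0 - q) * (x ^+ 3 / 6)
           - ((g * x0 - q) / alpha + (b - zd)) * (x ^+ 2 / 2)
           + Aalpha * x + Aalpha / alpha))).
Proof.
have alpha0 : alpha != 0 by rewrite gt_eqF.
have x00 : x0 != 0 by rewrite gt_eqF.
split.
  exists (H1_smooth hx0 hy0 (smooth_xpoly (state_poly x0 g q b))).
  exists (H1_smooth hx0 hy0 (smooth_xpoly (adjoint_poly x0 g q b zd 0))).
  exists (H1_smooth hx0 hy0
    (smooth_xpoly (state_poly x0 g q ((g * x0 - q) / alpha + b)))).
  exists (H1_smooth hx0 hy0 (smooth_xpoly (adjoint_poly x0 g q
    ((g * x0 - q) / alpha + b) zd
    (adjoint_slope x0 g q ((g * x0 - q) / alpha + b) zd / alpha)))).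
  split.
  - exact: is_state_xpoly.
  - by apply: is_adjoint_xpoly; exact: ae_eq_refl.
  - exact: is_state_alpha_xpoly.
  - by apply: is_adjoint_alpha_xpoly => //; exact: ae_eq_refl.
move=> u p ua pa us pus uas paus A Aalpha.
have uE := is_state_ae_eq hx0 hy0 us.
have pE := is_adjoint_ae_eq hx0 hy0 uE pus.
have uaE := is_state_alpha_ae_eq hx0 hy0 halpha uas.
have paE := is_adjoint_alpha_ae_eq hx0 hy0 halpha uaE paus.
have AalphaE : Aalpha = adjoint_slope x0 g q ((g * x0 - q) / alpha + b) zd.
  by rewrite /Aalpha /adjoint_slope; field; rewrite alpha0.
split; split.
- move: uE; apply: filterS => z /[apply] ->.
  by rewrite /xpoly /state_poly !hornerE/=; field.
- move: pE; apply: filterS => z /[apply] ->.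
  by rewrite /xpoly /adjoint_poly /A /adjoint_slope !hornerE/=; field.
- move: uaE; apply: filterS => z /[apply] ->.
  by rewrite /xpoly /state_poly !hornerE/=; field.
- move: paE; apply: filterS => z /[apply] ->.
  by rewrite AalphaE /xpoly /adjoint_poly !hornerE/=; field.
Qed.
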